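(* Let $F$ be a graph with $t:=|V(F)|\ge 3$ and let $n$ be an integer with $n\ge n_0(t):=9t+3$. If $G$ is an $n$-vertex nonhamiltonian graph, then $N(G,F)\le N(H_{n,1},F)$.
   Context: All graphs are finite and simple. A graph is nonhamiltonian if it has no hamiltonian cycle (a cycle through all its vertices). For graphs $G$ and $T$, $N(G,T)$ denotes the number of labeled copies of $T$ in $G$, i.e., the number of injections $\phi:V(T)\to V(G)$ such that for each $xy\in E(T)$, $\phi(x)\phi(y)\in E(G)$. $H_{n,1}$ is the $n$-vertex graph obtained from a complete graph $K_{n-1}$ by adding one new vertex adjacent to exactly one vertex of the $K_{n-1}$. *)

(* Defs.v *)
From mathcomp Require Import all_boot.

Set Implicit Arguments.
Unset Strict Implicit.
Unset Printing Implicit Defensive.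

Record sgraph := SGraph {
  vertex :> finType;
  adj : rel vertex;
  adj_sym : symmetric adj;
  adj_irr : irreflexive adj
}.

(* [ucycle] accepts the empty sequence and a single edge traversed back and
   forth; the lower bound on the size excludes them. *)
Definition is_cycle (G : sgraph) (c : seq G) : Prop :=
  3 <= size c /\ ucycle (@adj G) c.

Definition hamiltonian (G : sgraph) : Prop :=
  exists2 c : seq G, is_cycle c & forall x : G, x \in c.

Definition is_copy (G T : sgraph) (phi : {ffun T -> G}) : bool :=
  injectiveb phi && [forall x, forall y, adj x y ==> adj (phi x) (phi y)].

Definition num_copies (G T : sgraph) : nat :=
  #|[set phi : {ffun T -> G} | is_copy phi]|.

(* [Some i] ranges over the vertices of K_{n-1} and [None] is the added
   vertex, whose unique neighbour is the vertex of K_{n-1} with index 0.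
   The carrier has n elements when n > 0, and the neighbour exists when n > 1. *)
Definition pendant_adj (n : nat) : rel (option 'I_n.-1) :=
  fun u v =>
    match u, v with
    | Some i, Some j => i != j
    | None, Some j => j == 0 :> nat
    | Some i, None => i == 0 :> nat
    | None, None => false
    end.

Lemma pendant_adj_sym n : symmetric (@pendant_adj n).
Proof. by move=> [i|] [j|] //=; rewrite eq_sym. Qed.

Lemma pendant_adj_irr n : irreflexive (@pendant_adj n).
Proof. by move=> [i|] //=; rewrite eqxx. Qed.

Definition H1 (n : nat) : sgraph :=
  SGraph (@pendant_adj_sym n) (@pendant_adj_irr n).

Definition n0 (t : nat) : nat := 9 * t + 3.

(* Main.v *)
Require Import Defs.
From mathcomp Require Import all_boot.
From mathcomp Require Import perm zify.

Set Implicit Arguments.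
Unset Strict Implicit.
Unset Printing Implicit Defensive.

(** Write [n] for the number of vertices of [G].

    The structure of [G] enters through Posa's degree condition
    ([low_degrees_of_nonhamiltonian]): a nonhamiltonian graph has, for some
    [0 < k < n/2], at least [k] vertices of degree at most [k].

    If [k = 1], some vertex has degree at most one.  Sending it to the pendant
    vertex of [H1 n] and its neighbour to the attachment point embeds [G] in
    [H1 n] ([embed_pendant]), so every copy of [F] in [G] gives one in [H1 n].

    If [k >= 2], one compares the injections of the vertices of [F] that are
    not copies; [G] and [H1 n] have the same number [I] of injections.  Let [m]
    be the number of non-isolated vertices of [F].
    - An injection into [H1 n] which is not a copy sends some non-isolated
      vertex to the pendant vertex, so at most [m I / n] of them fail
      ([non_copies_upper_bound]).
    - Let [D] be a set of [k] vertices of [G] of degree at most [k], and sample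
      a set [S] of [s] non-isolated vertices of [F], with one edge of [F] chosen
      at each.  If exactly one vertex of [S] falls into [D], then the injection
      fails unless the edge chosen there is mapped to an edge, which is
      unlikely since degrees in [D] are small.  A union bound shows that a
      fraction of about [u (n - u) / n^2] of all injections fail, with
      [u = s k] ([non_copies_lower_bound]).
    Such a fraction is at least [m / n] when [u] lies between [2 m] and [n / 2]
    ([choose_sample_size]).  Sampling is essential: with all the non-isolated
    vertices in [S], the collisions in the union bound would dominate for
    large [k]. *)

(** * Degrees and hamiltonian cycles *)

Definition degree (G : sgraph) (x : G) : nat := #|[set y | adj x y]|.

Lemma subset_of_card (T : finType) (A : {set T}) (k : nat) :
  k <= #|A| -> exists2 B : {set T}, B \subset A & #|B| = k.
Proof.
move=> /card_geqP[s [us <- sA]]; exists [set x in s].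
  by apply/subsetP => x; rewrite inE; apply: sA.
by rewrite cardsE; apply/card_uniqP.
Qed.

Lemma size_spanning (T : finType) (s : seq T) :
  uniq s -> (forall x, x \in s) -> size s = #|T|.
Proof.
by move=> us sT; rewrite -(card_uniqP us); apply: eq_card => x; rewrite sT.
Qed.

Lemma spanning_cycle_hamiltonian (G : sgraph) (c : seq G) :
  3 <= #|G| -> uniq c -> (forall x, x \in c) -> cycle (@adj G) c ->
  hamiltonian G.
Proof.
move=> G3 uc cG cyc; exists c => //.
by split; [rewrite (size_spanning uc cG) | rewrite /ucycle cyc].
Qed.

Lemma next_last_cat (T : eqType) (x y : T) (p1 p2 : seq T) :
  uniq (x :: p1 ++ y :: p2) ->
  next (x :: p1 ++ y :: p2) (last x p1) = y.
Proof.
move=> us; rewrite next_nth.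
have -> : last x p1 = nth x (x :: p1 ++ y :: p2) (size p1).
  by rewrite (last_nth x) -cat_cons nth_cat /= ltnSn.
have lt_p1 : size p1 < size (x :: p1 ++ y :: p2) by rewrite /= size_cat /=; lia.
rewrite mem_nth // index_uniq //.
by rewrite nth_cat ltnn subnn.
Qed.

(** The cycle follows the path from [x] to the vertex before [y], jumps to the
    end of the path, and runs backwards to [y], which is joined to [x]. *)
Lemma rotated_cycle (G : sgraph) (x y : G) (p1 p2 : seq G) :
  path (@adj G) x (p1 ++ y :: p2) -> adj x y -> adj (last y p2) (last x p1) ->
  cycle (@adj G) (x :: p1 ++ rev (y :: p2)).
Proof.
rewrite cat_path /= => /and3P[px _ py] exy elast.
rewrite rcons_cat cat_path px /= lastI rev_rcons /= adj_sym elast /=.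
rewrite rcons_path.
have -> : path (@adj G) (last y p2) (rev (belast y p2)) = path (@adj G) y p2.
  by rewrite rev_path; apply: eq_path => a b; rewrite adj_sym.
rewrite py /=.
have -> : last (last y p2) (rev (belast y p2)) = y.
  by case: (p2) => //= a q; rewrite rev_cons last_rcons.
by rewrite adj_sym.
Qed.

(** Ore's rotation argument.  Neither the neighbours of [x] nor the
    successors on the path of the neighbours of its last vertex include [x],
    so by the degree hypothesis these two sets share a vertex [y], and the path
    can be closed up as in [rotated_cycle].  Successors are taken cyclically,
    with [next], which makes the successor map injective on all vertices. *)
Lemma ore_path (G : sgraph) (x : G) (p : seq G) :
  3 <= #|G| -> uniq (x :: p) -> (forall z, z \in x :: p) ->
  path (@adj G) x p -> #|G| <= degree x + degree (last x p) ->
  hamiltonian G.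
Proof.
move=> G3 us sG pxp dG.
set l := last x p in dG *.
pose B := [set next (x :: p) w | w in [set w | adj l w]].
have next_inj : injective (next (x :: p)) := can_inj (prev_next us).
have next_l : next (x :: p) l = x.
  rewrite next_nth sG /l (last_nth x) index_uniq //=.
  by rewrite nth_default.
have xA : x \notin [set y | adj x y] by rewrite inE adj_irr.
have xB : x \notin B.
  apply/negP => /imsetP[w]; rewrite inE => lw xw.
  by move: lw; rewrite -(next_inj _ _ (etrans next_l xw)) adj_irr.
have cardB : #|B| = degree l by apply: card_imset.
have [y yAB] : exists y, y \in [set y | adj x y] :&: B.
  apply/set0Pn; rewrite -card_gt0.
  have := cardsUI [set y | adj x y] B.
  have : #|[set y | adj x y] :|: B| < #|G|.
    rewrite -cardsT; apply: proper_card; apply/properP; split.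
      by apply: subsetT.
    by exists x; rewrite ?in_setT // in_setU (negbTE xA) (negbTE xB).
  by rewrite cardB; move: dG; rewrite /degree; lia.
move: yAB; rewrite inE => /andP[]; rewrite inE => exy /imsetP[w].
rewrite inE => elw yw.
have := sG w; rewrite -/l => win.
have {}win : exists p1 p2, p = p1 ++ p2 /\ w = last x p1.
  by case/splitPl: win => p1 p2 lw; exists p1, p2.
case: win => p1 [[|z p2]] [defp defw].
  by move: elw; rewrite /l defp cats0 -defw adj_irr.
have yz : y = z by rewrite yw defw defp next_last_cat // -defp.
apply: (@spanning_cycle_hamiltonian G (x :: p1 ++ rev (y :: p2))) => //.
- rewrite -cat_cons (perm_uniq (s2 := x :: p)) // defp yz -cat_cons.
  by rewrite perm_cat2l perm_rev.
- move=> a; rewrite -cat_cons (perm_mem (s2 := x :: p)) ?sG //.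
  rewrite defp yz -cat_cons.
  by rewrite perm_cat2l perm_rev.
- apply: rotated_cycle; rewrite ?yz -?defp //; first by rewrite -yz.
  by move: elw; rewrite /l defp last_cat defw.
Qed.

Section AddEdge.
Variables (G : sgraph) (u v : G).
Hypothesis neq_uv : u != v.

Definition add_edge_adj : rel G :=
  fun x y => [|| adj x y, (x == u) && (y == v) | (x == v) && (y == u)].

Lemma add_edge_adj_sym : symmetric add_edge_adj.
Proof.
move=> x y; rewrite /add_edge_adj adj_sym; congr (_ || _).
by rewrite orbC ![(_ == v) && _]andbC.
Qed.

Lemma add_edge_adj_irr : irreflexive add_edge_adj.
Proof.
move=> x; rewrite /add_edge_adj adj_irr /= [(x == v) && _]andbC orbb.
by apply/negP => /andP[/eqP xu /eqP xv]; move: neq_uv; rewrite -xu -xv eqxx.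
Qed.

Definition add_edge : sgraph := SGraph add_edge_adj_sym add_edge_adj_irr.

Lemma degree_add_edge (x : G) : degree x <= @degree add_edge x.
Proof.
by apply/subset_leq_card/subsetP => y; rewrite !inE /= /add_edge_adj => ->.
Qed.

Lemma add_edge_path (x : G) (p : seq G) :
  u \notin x :: p -> path add_edge_adj x p -> path (@adj G) x p.
Proof.
elim: p x => //= y p IH x; rewrite inE negb_or => /andP[xu ynu] /andP[exy py].
rewrite IH // andbT; move: exy ynu; rewrite /add_edge_adj inE negb_or.
rewrite [x == u]eq_sym [y == u]eq_sym (negbTE xu).
by move=> exy /andP[/negbTE yu _]; move: exy; rewrite yu andbF !orbF.
Qed.

(** The Bondy-Chvatal closure step.  Rotate a hamiltonian cycle of the larger
    graph to start at [u]: as [u] occurs once, the new edge can only be the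
    first or the closing edge.  If it occurs, removing it leaves a hamiltonian
    path of [G] between [u] and [v], to which [ore_path] applies. *)
Lemma ore_add_edge : 3 <= #|G| -> #|G| <= degree u + degree v ->
  hamiltonian add_edge -> hamiltonian G.
Proof.
move=> G3 dG [c [_ /andP[cyc uc]] cG].
have [i p defc] := rot_to (cG u).
move: cyc uc; rewrite -(rot_cycle i) -(rot_uniq i) defc.
have {}cG z : z \in (u :: p : seq G) by rewrite -defc mem_rot; apply: cG.
case: p defc cG => [|y q] defc cG cyc us.
  by move: (size_spanning us cG) G3 => /= <-.
move: cyc; rewrite /= rcons_path => /and3P[euy pyq elu].
have unq : u \notin (y :: q : seq G) by case/andP: us.
have {}pyq : path (@adj G) y q by apply: add_edge_path.
have yu : y == u = false.
  by apply/negP => /eqP yu; move: unq; rewrite inE -yu eqxx.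
have lu : last y q == u = false.
  by apply/negP => /eqP yu'; move: unq; rewrite -yu' mem_last.
have {}euy : @adj G u y || (y == v).
  by move: euy; rewrite /add_edge_adj yu eqxx andbF orbF.
have {}elu : @adj G (last y q) u || (last y q == v).
  by move: elu; rewrite /add_edge_adj lu eqxx /= andbT.
(* In the first case below the cycle starts with the new edge, so [y = v], and
   it cannot also end with it because it has at least three vertices. *)
case: (boolP (@adj G u y)) euy => [uy _|_ /= /eqP yv]; last first.
  have lu' : @adj G (last y q) u.
    case/orP: elu => // /eqP lv.
    have := size_spanning us cG; move: us; rewrite yv.
    case: (q) lv => [|a r] /= lv us sz; first by move: G3; rewrite -sz.
    by move: us; rewrite -lv mem_last !andbF.
  apply: (@ore_path G y (rcons q u)) => //.
  - by rewrite -rcons_cons rcons_uniq.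
  - by move=> z; rewrite -rcons_cons mem_rcons.
  - by rewrite rcons_path pyq.
  - by rewrite last_rcons yv addnC.
case: (boolP (@adj G (last y q) u)) elu => [lu' _|_ /= /eqP lv].
  apply: (@spanning_cycle_hamiltonian G (u :: y :: q)) => //.
  by rewrite /= rcons_path uy pyq.
apply: (@ore_path G u (y :: q)) => //=; first by rewrite uy.
by rewrite lv.
Qed.

End AddEdge.

Lemma complete_hamiltonian (G : sgraph) :
  3 <= #|G| -> (forall x y : G, x != y -> adj x y) -> hamiltonian G.
Proof.
move=> G3 cG; apply: (@spanning_cycle_hamiltonian _ (enum G)) => //.
- exact: enum_uniq.
- by move=> x; rewrite mem_enum.
case defs: (enum G) (enum_uniq G) => [//|x p] us.
have [y [q defq]] : exists y q, p = rcons q y.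
  case: (lastP p) defs => [|q y] defs; last by exists y, q.
  by move: G3; rewrite cardE defs.
rewrite /= rcons_path; apply/andP; split.
  apply: pairwise_sorted (_ : pairwise _ (x :: p)).
  apply: sub_pairwise (_ : pairwise [rel a b | a != b] _) => //.
  by rewrite -uniq_pairwise.
apply: cG; apply/eqP => lx; move: us; rewrite defq last_rcons in lx *.
by rewrite lx /= mem_rcons mem_head.
Qed.

(** Posa's theorem, by induction on the number of missing edges.  Take
    nonadjacent [u] and [v] with the largest degree sum, where
    [degree u <= degree v].  If the sum is at least [#|G|], then adding the
    edge keeps the graph nonhamiltonian and degrees only grow.  Otherwise every
    vertex not adjacent to [v] has degree at most [degree u] by maximality, and
    there are at least [degree u] of those apart from [v]. *)
Lemma low_degrees_of_nonhamiltonian (G : sgraph) :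
  3 <= #|G| -> ~ hamiltonian G ->
  exists k, [/\ 0 < k, k.*2 < #|G| & k <= #|[set x : G | degree x <= k]|].
Proof.
have [m] := ubnP (#|[set p : G * G | ~~ adj p.1 p.2]|).
elim: m G => // m IH G ltm G3 hamG.
pose na (p : G * G) := (p.1 != p.2) && ~~ adj p.1 p.2.
case: (pickP na) => [p0 nap0|nonna]; last first.
  case: hamG; apply: complete_hamiltonian => // x y xy.
  by have := nonna (x, y); rewrite /na /= xy /= => /negbFE.
have [[u v] /= /andP[/= uv nuv] maxuv] :=
  arg_maxnP (fun p => degree p.1 + degree p.2) nap0.
wlog duv : u v uv nuv maxuv / degree u <= degree v => [wl|].
  case: (leqP (degree u) (degree v)) => [|/ltnW] d; first exact: (wl u v).
  apply: (wl v u) => //; rewrite ?[v == u]eq_sym 1?adj_sym //=.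
  by move=> p /maxuv; rewrite [degree v + _]addnC.
case: (leqP #|G| (degree u + degree v)) => dG.
  have [|//||k [k0 kG kd]] := IH (add_edge uv).
  - rewrite -ltnS; apply: leq_trans ltm; rewrite ltnS.
    apply: proper_card; apply/properP; split.
      by apply/subsetP => q; rewrite !inE /= /add_edge_adj negb_or => /andP[].
    by exists (u, v); rewrite !inE //= /add_edge_adj !eqxx orbT.
  - by move/ore_add_edge => h; apply: hamG; apply: h.
  exists k; split=> //; apply: (leq_trans kd); apply: subset_leq_card.
  apply/subsetP => x; rewrite !inE; apply: leq_trans.
  exact: degree_add_edge.
have low : #|G| <= #|[set x : G | degree x <= degree u]| + degree v + 1.
  have sub : [set: G] \subset
      [set x : G | degree x <= degree u] :|: [set y | adj v y] :|: [set v].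
    apply/subsetP => w _; rewrite !inE.
    case: (boolP (w == v)) => [|wv]; rewrite ?orbT // orbF.
    case: (boolP (adj v w)) => [|vw]; rewrite ?orbT // orbF.
    have := maxuv (w, v); rewrite /na /= wv adj_sym vw /= => /(_ isT).
    by rewrite leq_add2r.
  rewrite -cardsT; apply: (leq_trans (subset_leq_card sub)).
  apply: (leq_trans (leq_card_setU _ _)); rewrite cards1 leq_add2r.
  exact: leq_card_setU.
(* An isolated [u] would give [k = 0]; then [k = 1] is used instead. *)
have u_low : 0 < #|[set x : G | degree x <= degree u]|.
  by apply/card_gt0P; exists u; rewrite inE.
exists (maxn 1 (degree u)); split; first by rewrite leq_max.
  have bound a b n : 2 < n -> a <= b -> a + b < n -> (maxn 1 a).*2 < n by lia.
  exact: bound G3 duv dG.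
have : #|[set x : G | degree x <= degree u]| <=
    #|[set x : G | degree x <= maxn 1 (degree u)]|.
  apply: subset_leq_card; apply/subsetP => x; rewrite !inE => dx.
  by rewrite leq_max dx orbT.
by apply: leq_trans; rewrite geq_max u_low; move: low dG; lia.
Qed.

(** * Counting injections *)

Lemma perm_2transitive (T : finType) (a b a' b' : T) :
  a != b -> a' != b' -> exists pi : {perm T}, pi a = a' /\ pi b = b'.
Proof.
move=> ab ab'; pose pi := tperm a a'.
have pib : pi b != a' by rewrite -(tpermL a a') (inj_eq perm_inj) eq_sym.
exists (pi * tperm (pi b) b')%g; rewrite !permM; split; last exact: tpermL.
by rewrite [pi a]tpermL tpermD // eq_sym.
Qed.

Lemma card_pairs (T U : finType) (P : {set T * U}) :
  #|P| = \sum_a #|[set b | (a, b) \in P]|.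
Proof.
under eq_bigr do rewrite -sum1dep_card.
by rewrite pair_big_dep /= -sum1_card; apply: eq_bigl => -[a b].
Qed.

Lemma card_offdiag (T : finType) (A B : {set T}) :
  A \subset B -> #|[set p in setX A B | p.1 != p.2]| = #|A| * #|B|.-1.
Proof.
move=> AB; rewrite card_pairs (bigID (mem A)) /=.
rewrite [X in _ + X]big1 ?addn0 => [|a nA].
  rewrite -sum_nat_const; apply: eq_bigr => a aA.
  have aB := subsetP AB _ aA; rewrite (cardsD1 a B) aB; apply: eq_card => b.
  by rewrite !inE /= aA andbC eq_sym.
apply/eqP; rewrite cards_eq0; apply/eqP/setP => b.
by rewrite !inE /= (negbTE nA).
Qed.

Section Injections.
Variables (D T : finType).

Definition injections : {set {ffun D -> T}} :=
  [set phi : {ffun D -> T} | injectiveb phi].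

Lemma sum_injections (b : pred {ffun D -> T}) :
  \sum_(phi in injections) (b phi : nat)
  = #|[set phi : {ffun D -> T} | (phi \in injections) && b phi]|.
Proof.
rewrite -sum1dep_card [RHS]big_mkcondr /=.
by apply: eq_bigr => phi _; case: (b phi).
Qed.

(** The pair of values of a random injection at two given points is uniform
    over the pairs of distinct elements: permuting the target maps the
    injections with one prescribed pair of values into those with another.  The
    identity is kept free of division and of falling factorials. *)
Lemma card_injections_pair (x y : D) (P : {set T * T}) : x != y ->
  #|T| * #|T|.-1
  * #|[set phi : {ffun D -> T} 
        | (phi \in injections) && ((phi x, phi y) \in P)]|
  = #|[set p in P | p.1 != p.2]| * #|injections|.
Proof.
move=> xy.
pose fib (p : T * T) :=
  #|[set phi : {ffun D -> T} | (phi \in injections) && ((phi x, phi y) == p)]|.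
have card_fib (Q : {set T * T}) :
    #|[set phi : {ffun D -> T} 
        | (phi \in injections) && ((phi x, phi y) \in Q)]|
    = \sum_(p in [set p in Q | p.1 != p.2]) fib p.
  rewrite -sum1dep_card.
  rewrite (partition_big (fun phi : {ffun D -> T} => (phi x, phi y))
    (mem [set p in Q | p.1 != p.2])) /=; last first.
    move=> phi /andP[]; rewrite !inE /= => /injectiveP phi_inj ->.
    by rewrite (inj_eq phi_inj).
  apply: eq_bigr => p; rewrite inE => /andP[pQ _].
  rewrite /fib -sum1dep_card; apply: eq_bigl => phi.
  by case: eqP => [->|]; rewrite ?pQ ?andbT // !andbF.
have fib_le (p q : T * T) : p.1 != p.2 -> q.1 != q.2 -> fib p <= fib q.
  case: p q => [a b] [a' b'] /= ab ab'.
  have [pi [pia pib]] := perm_2transitive ab ab'.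
  pose move_by (phi : {ffun D -> T}) := [ffun z => pi (phi z)].
  have move_inj : injective move_by.
    move=> phi psi /ffunP e; apply/ffunP => z; apply: (@perm_inj _ pi).
    by have := e z; rewrite !ffunE.
  rewrite /fib -(card_imset _ move_inj); apply/subset_leq_card/subsetP => psi.
  case/imsetP=> phi; rewrite !inE => /andP[/injectiveP phi_inj].
  move=> /eqP[phx phy] ->.
  rewrite !ffunE phx phy pia pib eqxx andbT; apply/injectiveP => z w.
  by rewrite !ffunE => /perm_inj /phi_inj.
have fib_eq (p q : T * T) : p.1 != p.2 -> q.1 != q.2 -> fib p = fib q.
  by move=> pd qd; apply/eqP; rewrite eqn_leq !fib_le.
have total :
    #|injections| = \sum_(p in [set p in [set: T * T] | p.1 != p.2]) fib p.
  by rewrite -card_fib; apply: eq_card => phi; rewrite !inE andbT.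
have off : #|[set p in [set: T * T] | p.1 != p.2]| = #|T| * #|T|.-1.
  rewrite -!cardsT -card_offdiag ?subxx //; apply: eq_card => p.
  by rewrite !inE.
rewrite total -off card_fib mulnC -!sum_nat_const big_distrl /=.
apply: eq_bigr => p; rewrite inE => /andP[_ pd].
rewrite mulnC -sum_nat_const; apply: eq_bigr => q; rewrite !inE /= => qd.
exact: fib_eq.
Qed.

End Injections.

(** * Injections that are not copies *)

Section Counting.
Variables (F : sgraph).

Definition non_isolated : {set F} := [set x | [exists y, adj x y]].

Definition neighbor (x : F) : F := odflt x [pick y | adj x y].

Lemma adj_neighbor (x : F) : x \in non_isolated -> adj x (neighbor x).
Proof.
rewrite inE /neighbor => /existsP[y xy]; case: pickP => //= /(_ y).
by rewrite xy.
Qed.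

Lemma neq_neighbor (x : F) : x \in non_isolated -> x != neighbor x.
Proof.
move=> /adj_neighbor adjx; apply/eqP => e; move: adjx; rewrite -e.
by rewrite adj_irr.
Qed.

Definition non_copies (G : sgraph) : {set {ffun F -> G}} :=
  [set phi : {ffun F -> G} | (phi \in injections F G) && ~~ is_copy phi].

Lemma num_copies_compl (G : sgraph) :
  num_copies G F + #|non_copies G| = #|G| ^_ #|F|.
Proof.
rewrite -card_inj_ffuns -/(injections F G).
rewrite -(cardsID [set phi : {ffun F -> G} | is_copy phi]).
congr (_ + _); apply: eq_card => phi; rewrite !inE; last by rewrite andbC.
by rewrite /is_copy; case: (injectiveb phi).
Qed.

(** Call [x] in [S] a hit of an injection if it is sent into [D].  The number
    of hits is at most the number of hits whose chosen edge is kept, plus the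
    number of ordered pairs of distinct hits, plus one if the injection is not a
    copy.  Summing over injections, each of the three kinds of event about a
    vertex or a pair of vertices is evaluated by [card_injections_pair]. *)
Lemma non_copies_lower_bound (G : sgraph) (D : {set G}) (S : {set F})
    (k : nat) :
  #|D| = k -> {in D, forall v, degree v <= k} -> S \subset non_isolated ->
  #|S| * (k * #|G|.-1) * #|injections F G| <=
  #|G| * #|G|.-1 * #|non_copies G|
  + (#|S| * (k * k) + #|S| * #|S|.-1 * (k * k.-1)) * #|injections F G|.
Proof.
move=> cardD degD SW; set Inj := injections F G; set M := #|G| * #|G|.-1.
pose hit (phi : {ffun F -> G}) x := phi x \in D.
pose ok (phi : {ffun F -> G}) x := hit phi x && adj (phi x) (phi (neighbor x)).
pose hit2 (phi : {ffun F -> G}) x y := hit phi x && hit phi y.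
have pointwise (phi : {ffun F -> G}) : phi \in Inj ->
    \sum_(x in S) (hit phi x : nat) <= (~~ is_copy phi : nat)
      + \sum_(x in S) (ok phi x : nat)
      + \sum_(x in S) \sum_(y in S | y != x) (hit2 phi x y : nat).
  move=> phiI; case: (pickP [pred x in S | hit phi x])
    => [x0 /andP[x0S x0D]|none]; last first.
    rewrite big1 // => x xS; have := none x; rewrite /= xS /= => ->.
    by [].
  case: (pickP [pred x in S | hit phi x && (x != x0)])
    => [x1 /and3P[x1S x1D x10]|one].
    (* Two hits: each hit x forms a colliding pair with x0 or with x1. *)
    rewrite (leq_trans _ (leq_addl _ _)) //; apply: leq_sum => x xS.
    case hx: (hit phi x) => //.
    case: (eqVneq x x0) => [->|xx0].
      by rewrite (bigD1 x1) ?x1S //= /hit2 x0D x1D.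
    by rewrite (bigD1 x0) ?x0S /= 1?eq_sym // /hit2 hx x0D.
  (* A single hit x0: either its chosen edge is kept, or phi is no copy. *)
  rewrite (leq_trans _ (leq_addr _ _)) // (bigD1 x0) //=.
  rewrite big1 ?addn0; last first.
    by move=> x /andP[xS xx0]; have := one x; rewrite /= xS xx0 andbT /= => ->.
  rewrite (bigD1 x0 x0S) /= addnA (leq_trans _ (leq_addr _ _)) //.
  rewrite x0D /ok x0D /=; case ax: (adj _ _); rewrite ?addn1 //.
  suff -> : is_copy phi = false by [].
  apply/negP => /andP[_ /forallP/(_ x0)/forallP/(_ (neighbor x0))/implyP].
  by rewrite ax (adj_neighbor (subsetP SW _ x0S)) => /(_ isT).
have sum_pairs (P : {set G * G}) x y : x != y -> forall c : nat,
    #|[set p in P | p.1 != p.2]| <= c ->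
    M * \sum_(phi in Inj) ((phi x, phi y) \in P : nat) <= c * #|Inj|.
  move=> xy c Pc; rewrite (sum_injections (fun phi => (phi x, phi y) \in P)).
  by rewrite (card_injections_pair _ xy) leq_mul2r Pc orbT.
have sum_hit x : x \in S ->
    M * \sum_(phi in Inj) (hit phi x : nat) = k * #|G|.-1 * #|Inj|.
  move=> xS; have xn := neq_neighbor (subsetP SW _ xS).
  have := card_injections_pair (setX D setT) xn.
  rewrite card_offdiag ?subsetT // cardD cardsT -/Inj => <-.
  rewrite sum_injections; congr (_ * _); apply: eq_card => phi.
  by rewrite !inE /= andbT.
have sum_ok x : x \in S ->
    M * \sum_(phi in Inj) (ok phi x : nat) <= k * k * #|Inj|.
  move=> xS; have xn := neq_neighbor (subsetP SW _ xS).
  pose P := [set p : G * G | (p.1 \in D) && adj p.1 p.2].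
  have -> : \sum_(phi in Inj) (ok phi x : nat)
      = \sum_(phi in Inj) ((phi x, phi (neighbor x)) \in P : nat).
    by apply: eq_bigr => phi _; rewrite inE.
  apply: sum_pairs => //.
  apply: (@leq_trans #|P|).
    by apply/subset_leq_card/subsetP => p /[!inE] /andP[].
  (* There are at most k * k ordered edges leaving D. *)
  rewrite card_pairs (bigID (mem D)) /= [X in _ + X]big1 ?addn0 => [|v nD].
    rewrite -[k in k * _]cardD -sum_nat_const; apply: leq_sum => v vD.
    apply: leq_trans (degD v vD); apply/subset_leq_card/subsetP => w.
    by rewrite !inE => /andP[].
  apply/eqP; rewrite cards_eq0; apply/eqP/setP => w.
  by rewrite !inE /= (negbTE nD).
have sum_hit2 x y : y != x ->
    M * \sum_(phi in Inj) (hit2 phi x y : nat) <= k * k.-1 * #|Inj|.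
  rewrite eq_sym => xy.
  have -> : \sum_(phi in Inj) (hit2 phi x y : nat)
      = \sum_(phi in Inj) ((phi x, phi y) \in setX D D : nat).
    by apply: eq_bigr => phi _; rewrite inE.
  by apply: sum_pairs => //; rewrite card_offdiag ?subxx // cardD.
have : M * \sum_(phi in Inj) \sum_(x in S) (hit phi x : nat) <=
    M * \sum_(phi in Inj) ((~~ is_copy phi : nat)
      + \sum_(x in S) (ok phi x : nat)
      + \sum_(x in S) \sum_(y in S | y != x) (hit2 phi x y : nat)).
  by rewrite leq_mul2l leq_sum ?orbT.
rewrite !big_split /= sum_injections -/(non_copies G) exchange_big /= !mulnDr.
rewrite big_distrr /= (eq_bigr (fun=> k * #|G|.-1 * #|Inj|)); last first.
  exact: sum_hit.
rewrite sum_nat_const mulnA => /leq_trans; apply.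
rewrite -addnA leq_add2l mulnDl; apply: leq_add.
  rewrite exchange_big big_distrr -mulnA -sum_nat_const /=.
  exact: leq_sum.
rewrite exchange_big big_distrr -!mulnA -sum_nat_const /=.
apply: leq_sum => x xS; rewrite exchange_big big_distrr /=.
have -> : #|S|.-1 = #|[set y in S | y != x]|.
  by rewrite (cardsD1 x S) xS; apply: eq_card => y; rewrite !inE andbC.
rewrite -sum_nat_const.
rewrite [leqRHS](eq_bigl (fun y => (y \in S) && (y != x))) => [|y].
  by apply: leq_sum => y /andP[_ yx]; rewrite mulnA sum_hit2.
by rewrite inE.
Qed.

(** Two vertices of [H1 n] other than [None] are always adjacent, so a broken
    edge of [F] has an end sent to [None]. *)
Lemma non_copies_upper_bound (n : nat) : 0 < n ->
  n * n.-1 * #|non_copies (H1 n)|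
  <= #|non_isolated| * n.-1 * #|injections F (H1 n)|.
Proof.
move=> n0; have cardH : #|H1 n| = n by rewrite card_option card_ord prednK.
set Inj := injections F (H1 n).
have pointwise (phi : {ffun F -> H1 n}) : phi \in Inj ->
    (~~ is_copy phi : nat) <= \sum_(x in non_isolated) (phi x == None : nat).
  rewrite inE => phi_inj; case: (boolP (is_copy phi)) => // /nandP[/negP //|].
  rewrite negb_forall => /existsP[x]; rewrite negb_forall => /existsP[y].
  rewrite negb_imply => /andP[xy nphi].
  have xW : x \in non_isolated by rewrite inE; apply/existsP; exists y.
  have yW : y \in non_isolated.
    by rewrite inE; apply/existsP; exists x; rewrite adj_sym.
  have phixy : phi x != phi y.
    rewrite (inj_eq (injectiveP _ phi_inj)); apply/eqP => e.
    by move: xy; rewrite e adj_irr.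
  case ex: (phi x) => [i|]; last by rewrite (bigD1 x) //= ex.
  case ey: (phi y) => [j|]; last by rewrite (bigD1 y) //= ey.
  by move: nphi phixy; rewrite ex ey /= => /negPn/eqP ->; rewrite eqxx.
have le_sum : #|non_copies (H1 n)| <=
    \sum_(phi in Inj) \sum_(x in non_isolated) (phi x == None : nat).
  by rewrite -sum_injections; apply: leq_sum => phi; apply: pointwise.
apply: (leq_trans (leq_mul (leqnn _) le_sum)).
rewrite exchange_big big_distrr -mulnA -sum_nat_const /=.
apply: leq_sum => x xW.
have := card_injections_pair (setX [set (None : H1 n)] setT) (neq_neighbor xW).
rewrite card_offdiag ?subsetT // cards1 mul1n cardsT cardH -/Inj => <-.
rewrite (sum_injections (fun phi : {ffun F -> H1 n} => phi x == None)).
rewrite leq_mul2l; apply/orP; right; apply: eq_leq; apply: eq_card => phi.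
by rewrite !inE andbT.
Qed.
End Counting.

(** * Comparison with the pendant graph *)

Lemma num_copies_monotone (F G H : sgraph) (f : G -> H) :
  injective f -> (forall x y, adj x y -> adj (f x) (f y)) ->
  num_copies G F <= num_copies H F.
Proof.
move=> f_inj f_hom; pose post (phi : {ffun F -> G}) := [ffun z => f (phi z)].
have post_inj : injective post.
  move=> phi psi /ffunP e; apply/ffunP => z; apply: f_inj.
  by have := e z; rewrite !ffunE.
rewrite /num_copies -(card_imset _ post_inj).
apply/subset_leq_card/subsetP => psi.
case/imsetP => phi; rewrite !inE => /andP[/injectiveP phi_inj hom] ->.
apply/andP; split.
  by apply/injectiveP => z w; rewrite !ffunE => /f_inj/phi_inj.
apply/forallP => z; apply/forallP => w; apply/implyP => zw; rewrite !ffunE.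
by apply: f_hom; move/forallP/(_ z)/forallP/(_ w)/implyP: hom; apply.
Qed.

(** Any bijection can be corrected by a permutation so that [v] goes to the
    pendant vertex and its only possible neighbour to the attachment point; the
    other vertices of [H1 n] are pairwise adjacent. *)
Lemma embed_pendant (G : sgraph) (n : nat) (v : G) :
  1 < n -> #|G| = n -> degree v <= 1 ->
  exists2 f : G -> H1 n, injective f & forall x y, adj x y -> adj (f x) (f y).
Proof.
move=> n1 cardG dv.
have [u uv nbr] : exists2 u, u != v & forall w, adj v w -> w = u.
  case: (pickP (adj v)) => [u vu|none].
    exists u; first by apply/eqP => e; move: vu; rewrite e adj_irr.
    move=> w vw; apply/eqP/negPn/negP => wu.
    move: dv; rewrite leqNgt => /negP; apply.
    by rewrite /degree (cardsD1 u) (cardsD1 w) !inE vu vw wu.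
  have /card_gt0P[u] : 0 < #|[set~ v]|.
    by rewrite cardsC1 cardG; case: (n) n1 => [|[]].
  by rewrite !inE => uv; exists u => // w; rewrite none.
have cardGH : #|G| = #|H1 n|.
  by rewrite cardG card_option card_ord prednK // ltnW.
have n0 : 0 < n.-1 by case: (n) n1 => [|[]].
pose g x : H1 n := enum_val (cast_ord cardGH (enum_rank x)).
have g_inj : injective g.
  by move=> x y /enum_val_inj/cast_ord_inj/enum_rank_inj.
have guv : g v != g u by rewrite (inj_eq g_inj) eq_sym.
have [pi [piv piu]] := @perm_2transitive (H1 n) (g v) (g u)
  None (Some (Ordinal n0)) guv isT.
have f_inj : injective (pi \o g) by apply: inj_comp g_inj; apply: perm_inj.
exists (pi \o g) => // x y xy /=.
have fv z : adj v z -> adj (pi (g v)) (pi (g z)).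
  by move=> /nbr ->; rewrite piv piu.
case: (eqVneq x v) => [e|xv]; first by rewrite e; apply: fv; rewrite -e.
case: (eqVneq y v) => [e|yv].
  by rewrite e pendant_adj_sym; apply: fv; rewrite -e adj_sym.
have some z : z != v -> exists i, pi (g z) = Some i.
  move=> zv; case e: (pi (g z)) => [i|]; first by exists i.
  by move: zv; rewrite -(inj_eq f_inj) /= e piv.
have [i fx] := some x xv; have [j fy] := some y yv.
have : pi (g x) != pi (g y).
  rewrite -[_ == _]/((pi \o g) x == (pi \o g) y) (inj_eq f_inj).
  by apply/eqP => e; move: xy; rewrite e adj_irr.
by rewrite fx fy.
Qed.

(** With [u = s * k] the conclusion follows from [m * N + u * u <= u * N],
    which holds as soon as [2 m <= u <= N / 2].  If [k >= 2 m], take [s = 1];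
    otherwise take the least [s] with [s * k >= 2 m], which overshoots by less
    than [k] and stays below [4 m]; it is at most [m] because [k >= 2]. *)
Lemma choose_sample_size (m k N : nat) :
  0 < m -> 1 < k -> k.*2 <= N -> 8 * m <= N ->
  exists2 s, s <= m &
    m * N + (s * (k * k) + s * s.-1 * (k * k.-1)) <= s * (k * N).
Proof.
move=> m0 k1 kN mN.
have square u : m.*2 <= u -> u.*2 <= N -> m * N + u * u <= u * N.
  move=> mu uN; have := leq_mul mu (leqnn N); have := leq_mul (leqnn u) uN.
  by lia.
have [mk|km] := leqP m.*2 k.
  by exists 1 => //; have := square _ mk kN; lia.
pose s := (m.*2 + k.-1) %/ k.
have k0 : 0 < k by lia.
have s_le : s * k <= m.*2 + k.-1 := leq_trunc_div _ _.
have s_gt : m.*2 + k.-1 < s.+1 * k := ltn_ceil _ k0.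
have s1 : 0 < s by case: (posnP s) s_gt => // ->; lia.
exists s.
  rewrite leqNgt; apply/negP => ms.
  by have := leq_mul ms (leqnn k); have := leq_mul (leqnn m) k1; lia.
have pairs_le : k + s.-1 * k.-1 <= s * k.
  by case: (s) (k) s1 k0 => [|s'] // [|k'] // _ _ /=; lia.
have := leq_mul (leqnn (s * k)) pairs_le.
have := square (s * k); rewrite mulSn in s_gt.
have -> : s * (k * k) + s * s.-1 * (k * k.-1) = s * k * (k + s.-1 * k.-1).
  by lia.
rewrite (mulnA s).
by move: (s * k * N) (_ * (k + _)) (_ * (s * k)) => a b c; lia.
Qed.

Theorem corollary5 (F : sgraph) (n : nat) (G : sgraph) :
  3 <= #|F| -> n0 #|F| <= n -> #|G| = n -> ~ hamiltonian G ->
  num_copies G F <= num_copies (H1 n) F.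
Proof.
rewrite /n0 => F3 nF cardG hamG.
have G3 : 3 <= #|G| by rewrite cardG; lia.
have [k [k0 kn low]] := low_degrees_of_nonhamiltonian G3 hamG.
have [k1|k1] := leqP k 1.
  have {k0 k1}k1 : k = 1 by lia.
  move: low; rewrite k1 => /card_gt0P[v]; rewrite inE => dv.
  have n1 : 1 < n by lia.
  have [f f_inj f_hom] := embed_pendant n1 cardG dv.
  exact: num_copies_monotone f_inj f_hom.
have [D Dlow cardD] := subset_of_card low.
have degD : {in D, forall v, degree v <= k}.
  by move=> v /(subsetP Dlow); rewrite inE.
have n_gt0 : 0 < n by lia.
have cardH : #|H1 n| = n by rewrite card_option card_ord prednK.
have := num_copies_compl F G; have := num_copies_compl F (H1 n).
rewrite cardH cardG => complH complG.
suff : #|non_copies F (H1 n)| <= #|non_copies F G| by lia.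
have up := non_copies_upper_bound F n_gt0.
have injH : #|injections F (H1 n)| = n ^_ #|F| by rewrite card_inj_ffuns cardH.
have injG : #|injections F G| = n ^_ #|F| by rewrite card_inj_ffuns cardG.
have M0 : 0 < n * n.-1 by rewrite muln_gt0; lia.
rewrite -(leq_pmul2l M0); apply: leq_trans up _; rewrite injH.
have [->|W0] := posnP #|non_isolated F|; first by rewrite !mul0n.
have WF : #|non_isolated F| <= #|F| := max_card _.
have [||s sW s_bound] := @choose_sample_size #|non_isolated F| k n.-1 W0 k1.
- by move: kn; rewrite cardG; lia.
- by lia.
have [S SW cardS] := subset_of_card sW.
have := non_copies_lower_bound cardD degD SW.
rewrite cardS cardG injG.
rewrite -(leq_add2r (#|non_isolated F| * n.-1 * n ^_ #|F|)) => lower.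
have := leq_mul s_bound (leqnn (n ^_ #|F|)); rewrite mulnDl.
by move: lower; lia.
Qed.
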